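(* Let $(A,+,\circ)$ be a left brace of cardinality $p^{n}$, where $p$ is a prime with $p>n+1$. Let $\gamma$ be a primitive root modulo $p^{p}$ and $\xi=\gamma^{p^{p-1}}$. Define on $A/ann(p^{2})$ \[[x]\bullet[y]=\sum_{i=0}^{p-2}\xi^{p-1-i}\,[\xi^{i}x]\odot[y],\qquad x,y\in A,\] where $[x]\odot[y]=[\wp^{-1}((px)*y)]$. Then $(A/ann(p^{2}),+,\bullet)$ is a pre-Lie ring.
   Context: A (left) brace is a set $A$ with operations $+,\circ$ such that $(A,+)$ is an abelian group, $(A,\circ)$ is a group, and $a\circ(b+c)+a=a\circ b+a\circ c$; $a*b=a\circ b-a-b$. $pA=\{pa:a\in A\}$; $\wp^{-1}:pA\to A$ is a fixed function with $p\,\wp^{-1}(a)=a$. $ann(p^{2})=\{a\in A:p^{2}a=0\}$ is an ideal (for $p>n+1$) and $[a]=a+ann(p^{2})$; the operation $\odot$ is well defined on cosets. A pre-Lie ring is an abelian group with a bi-additive operation $\cdot$ satisfying $(x\cdot y)\cdot z-x\cdot(y\cdot z)=(y\cdot x)\cdot z-y\cdot(x\cdot z)$. *)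

(* Defs.v *)
From HB Require Import structures.
From mathcomp Require Import all_boot all_order all_algebra.
Set Implicit Arguments. Unset Strict Implicit. Unset Printing Implicit Defensive.
Import GRing.Theory.
Local Open Scope ring_scope.

Definition is_left_brace (A : zmodType) (circ : A -> A -> A) : Prop :=
  [/\ associative circ,
      (exists e : A, left_id e circ /\ right_id e circ /\
         (forall a, exists b, circ a b = e /\ circ b a = e))
    & forall a b c : A, circ a (b + c) + a = circ a b + circ a c].

Definition brace_star (A : zmodType) (circ : A -> A -> A) (a b : A) : A :=
  circ a b - a - b.

Definition mod_ann (A : zmodType) (m : nat) (x y : A) : Prop :=
  (x - y) *+ m = 0.

Definition odot (A : zmodType) (p : nat) (circ : A -> A -> A) (wp : A -> A)
  (x y : A) : A := wp (brace_star circ (x *+ p) y).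

Definition bullet (A : zmodType) (p xi : nat) (circ : A -> A -> A)
  (wp : A -> A) (x y : A) : A :=
  \sum_(i < p.-1) odot p circ wp (x *+ (xi ^ i)%N) y *+ (xi ^ (p.-1 - i))%N.

(* (R/E, +, op) is a pre-Lie ring, where E is a congruence on the abelian group
   R (given by representatives): op is well defined on classes, bi-additive,
   and satisfies the left pre-Lie identity on classes. *)
Definition preLie_mod (R : zmodType) (E : R -> R -> Prop) (op : R -> R -> R)
  : Prop :=
  [/\ (forall x x' y y', E x x' -> E y y' -> E (op x y) (op x' y')),
      (forall x x' y, E (op (x + x') y) (op x y + op x' y)),
      (forall x y y', E (op x (y + y')) (op x y + op x y'))
    & (forall x y z,
        E (op (op x y) z - op x (op y z)) (op (op y x) z - op y (op x z)))].

(* Main.v *)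
Require Import Defs.
From HB Require Import structures.
From mathcomp Require Import all_boot all_order all_algebra.
From mathcomp Require Import all_fingroup all_solvable zify.
Import GRing.Theory.
Local Open Scope ring_scope.
Set Implicit Arguments. Unset Strict Implicit. Unset Printing Implicit Defensive.

(** Write lam_a for the additive automorphism u |-> a o u - a, so that
    a * u = lam_a u - u. Since the p-group (A, o) acts on the p-group (A, +), any
    n operators u |-> a * u compose to 0. As n < p - 1, p-th powers for o then
    show that p^i A * p^j A lies in p^(i+j) A.

    Call a function of integer variables p-analytic if its k-th finite
    differences are divisible by p^k. By lam_(a+d) = lam_a lam_(lam_a^-1 d),
    p-analytic functions are stable under (f, u) |-> lam_f u and lam_f^-1 u. Hence
    s |-> lam_(s a) z, for a in pA, is a polynomial in s of degree < p - 1, and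
    averaging over the (p-1)-th roots of unity xi^i extracts its linear
    coefficient D_a z. The same argument in two variables makes a |-> D_a
    additive. Comparing the coefficients of s t in
    lam_(s a) lam_(t b) = lam_(s a + t lam_(s a) b) shows that
    D_a D_b - D_(D_a b) is symmetric in a and b. Finally
    p (x . y) = (p - 1) D_(p x) y, which transfers this to the pre-Lie identity
    for the product on A / ann(p^2). *)

(* Both are locked because unification would otherwise unfold [lam a u] to
   match a difference. *)
HB.lock Definition lam (A : zmodType) (circ : A -> A -> A) (a u : A) : A :=
  circ a u - a.
HB.lock Definition star (A : zmodType) (circ : A -> A -> A) (a u : A) : A :=
  lam circ a u - u.

Lemma brace_starE (A : zmodType) (circ : A -> A -> A) a u :
  brace_star circ a u = star circ a u.
Proof. by rewrite star.unlock lam.unlock. Qed.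

(** * The maps [lam] and [star] of a left brace *)

Section LeftBrace.
Variables (A : zmodType) (circ : A -> A -> A).
Hypothesis brA : is_left_brace circ.

Local Notation lam := (lam circ).
Local Notation star := (star circ).

Lemma starE a u : star a u = lam a u - u. Proof. by rewrite star.unlock. Qed.
Lemma lamE a u : lam a u = star a u + u. Proof. by rewrite starE subrK. Qed.
Lemma circE a b : circ a b = a + lam a b. Proof. by rewrite lam.unlock addrC subrK. Qed.

Lemma circA : associative circ. Proof. by case: brA. Qed.

Lemma lamD a u v : lam a (u + v) = lam a u + lam a v.
Proof.
case: brA => _ _ /(_ a u v) h; rewrite lam.unlock addrACA -h.
by rewrite addrA addrK.
Qed.

Lemma lam0 a : lam a 0 = 0.
Proof. by apply: (addrI (lam a 0)); rewrite -lamD !addr0. Qed.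

Lemma circ0 a : circ a 0 = a. Proof. by rewrite circE lam0 addr0. Qed.

Lemma circ0l a : circ 0 a = a.
Proof.
case: brA => _ [e [el [er _]]] _.
(* The unit e of [circ] is the additive zero: e = e o 0 = 0. *)
by have <- : e = 0 by rewrite -[LHS]circ0 el.
Qed.

Lemma circ_inv_ex a : exists b, (circ a b == 0) && (circ b a == 0).
Proof.
case: brA => _ [e [el [er /(_ a) [b [hb hb']]]]] _; exists b.
have e0 : e = 0 by rewrite -[LHS]circ0 el.
by rewrite hb hb' e0 eqxx.
Qed.

Definition cinv a : A := xchoose (circ_inv_ex a).

Lemma circV a : circ a (cinv a) = 0.
Proof. by case/andP: (xchooseP (circ_inv_ex a)) => /eqP. Qed.

Lemma circVl a : circ (cinv a) a = 0.
Proof. by case/andP: (xchooseP (circ_inv_ex a)) => _ /eqP. Qed.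

Lemma lamN a u : lam a (- u) = - lam a u.
Proof. by apply: (addrI (lam a u)); rewrite -lamD !subrr lam0. Qed.

Lemma lamB a u v : lam a (u - v) = lam a u - lam a v.
Proof. by rewrite lamD lamN. Qed.

Lemma lamMn a u m : lam a (u *+ m) = lam a u *+ m.
Proof. by elim: m => [|m IH]; rewrite ?mulr0n ?lam0 // !mulrS lamD IH. Qed.

Lemma lam_sum a I (r : seq I) (P : pred I) (F : I -> A) :
  lam a (\sum_(i <- r | P i) F i) = \sum_(i <- r | P i) lam a (F i).
Proof. exact: (big_morph (lam a) (lamD a) (lam0 a)). Qed.

Lemma lam_circ a b u : lam (circ a b) u = lam a (lam b u).
Proof.
apply: (addrI (circ a b)); rewrite -circE [in RHS]circE -addrA -lamD -circE.
by rewrite -circA -circE.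
Qed.

Lemma lam0l u : lam 0 u = u. Proof. by rewrite lam.unlock circ0l subr0. Qed.

Lemma lamK a u : lam (cinv a) (lam a u) = u.
Proof. by rewrite -lam_circ circVl lam0l. Qed.

Lemma lamKV a u : lam a (lam (cinv a) u) = u.
Proof. by rewrite -lam_circ circV lam0l. Qed.

Lemma starD a u v : star a (u + v) = star a u + star a v.
Proof. by rewrite !starE lamD opprD addrACA. Qed.

Lemma star0 a : star a 0 = 0. Proof. by rewrite starE lam0 subrr. Qed.

Lemma starN a u : star a (- u) = - star a u.
Proof. by rewrite !starE lamN opprB opprK addrC. Qed.

Lemma starB a u v : star a (u - v) = star a u - star a v.
Proof. by rewrite starD starN. Qed.

Lemma starMn a u m : star a (u *+ m) = star a u *+ m.
Proof. by rewrite !starE lamMn mulrnBl. Qed.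

Lemma star0l u : star 0 u = 0. Proof. by rewrite starE lam0l subrr. Qed.

Lemma star_circ a b u : star (circ a b) u = star a u + star b u + star a (star b u).
Proof.
rewrite [star (circ a b) u]starE lam_circ [lam b u]lamE lamD !lamE.
by rewrite addrA addrK [LHS]addrC [star a (star b u) + _]addrC addrA.
Qed.

(** An additive increment of the index becomes a right factor for [circ], as a + d = a o lam_a^-1 d.
    This gives access to differences of [lam] in its first argument. *)
Lemma lamDl a d u : lam (a + d) u = lam a u + lam a (star (lam (cinv a) d) u).
Proof.
have -> : a + d = circ a (lam (cinv a) d) by rewrite circE lamKV.
by rewrite lam_circ [lam (lam _ _) u]lamE lamD addrC.
Qed.

End LeftBrace.

(** * Fixed points of a p-group on a quotient *)

Section PGroupAction.
Local Open Scope group_scope.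
Local Open Scope ring_scope.

(** The p-group permutes the cosets of Z, whose number is divisible by p because Z is proper. So p
    divides the number of fixed cosets; Z is one of them, hence there is another, and x is a
    representative of it. *)
Lemma pgroup_fix_quotient (A : finZmodType) (gT : finGroupType)
    (to : {action gT &-> A}) (p : nat) (Z : {group A}) :
  prime p -> (p.-group [set: gT])%g -> p.-nat #|A| ->
  (forall g, {morph to^~ g : x y / x + y}) ->
  (forall g x, x \in Z -> to x g \in Z) ->
  Z != [set: A] :> {set A} ->
  exists2 x, x \notin Z & forall g, to x g - x \in Z.
Proof.
move=> p_pr pG pA toD toZ neqZT; pose S := rcosets Z [set: A].
have to0 g : to 0 g = 0 by apply: (addrI (to 0 g)); rewrite -toD !addr0.
have im_coset (C : {set A}) x g : C = (Z :* x)%g -> (to^*)%act C g = (Z :* to x g)%g.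
  move=> ->; apply/setP=> y; apply/imsetP/rcosetP.
    by case=> _ /rcosetP[z Zz ->] ->; exists (to z g); rewrite ?toZ ?toD.
  case=> z Zz ->; exists (to z g^-1%g + x); last by rewrite toD actKV.
  by apply/rcosetP; exists (to z g^-1%g); rewrite ?toZ.
have actS : [acts [set: gT], on S | to^*].
  apply/subsetP=> g _; rewrite !inE /=; apply/subsetP=> C.
  by case/rcosetsP=> x _ /im_coset imC; rewrite inE imC; apply/rcosetsP; exists (to x g).
have := pgroup_fix_mod pG actS.
have -> : (#|S| = 0 %[mod p])%N.
  apply/eqP; rewrite mod0n -/(dvdn p _) -[#|S|]/(#|[set: A] : Z|%g).
  have: p.-nat #|[set: A] : Z|%g by apply: pnat_dvd (dvdn_indexg _ _) _; rewrite cardsT.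
  case/p_natP=> -[|k] e; last by rewrite e expnS dvdn_mulr.
  move/eqP: e; rewrite -[(p ^ 0)%N]/1%N indexg_eq1 => sTZ.
  by case/eqP: neqZT; apply/eqP; rewrite eqEsubset subsetT.
move/esym/eqP; rewrite mod0n => dvF.
have ZF : (Z : {set A}) \in 'Fix_(S | to^*)([set: gT]).
  rewrite inE; apply/andP; split; first by apply/rcosetsP; exists 1%g; rewrite ?mulg1.
  by apply/afixP=> g _; rewrite (im_coset _ 1%g) ?mulg1 //= to0 mulg1.
have /card_gt1P[C [D [CF DF neqCD]]] : (1 < #|'Fix_(S | to^*)([set: gT])|)%N.
  apply: leq_trans (prime_gt1 p_pr) (dvdn_leq _ dvF).
  by apply/card_gt0P; exists (Z : {set A}).
have {C D CF DF neqCD} [C] : exists2 C, C \in 'Fix_(S | to^*)([set: gT])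
    & C != Z :> {set A}.
  by have [eC|] := eqVneq C Z; [exists D; rewrite // -eC eq_sym | exists C].
rewrite inE => /andP[/rcosetsP[x _ eC] /afixP fixC] neqCZ; exists x.
  by apply: contra neqCZ => Zx; rewrite eC rcoset_id.
move=> g; have: to x g \in C by rewrite -(fixC g) ?inE // (im_coset _ x) ?rcoset_refl.
by rewrite eC mem_rcoset.
Qed.

End PGroupAction.

(** * The group (A, o) and its action on (A, +) *)

Section MultiplicativeGroup.
Variables (A : finZmodType) (circ : A -> A -> A).

Definition mult_group of is_left_brace circ : Type := A.
Variable brA : is_left_brace circ.
Local Notation G := (mult_group brA).

HB.instance Definition _ := Finite.on G.
HB.instance Definition _ := Finite_isGroup.Build G
  (circA brA) (circ0l brA) (circVl brA).

(* Permutation actions are right actions, hence the inverse. *)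
Definition lam_act (x : A) (a : G) : A := lam circ (a^-1)%g x.

Lemma lam_act1 x : lam_act x 1%g = x.
Proof. by rewrite /lam_act invg1; exact: lam0l. Qed.

Lemma lam_actM x (a b : G) : lam_act x (a * b)%g = lam_act (lam_act x a) b.
Proof. by rewrite /lam_act invMg; exact: lam_circ. Qed.

Definition lam_action : {action G &-> A} := TotalAction lam_act1 lam_actM.

End MultiplicativeGroup.

(** * Left nilpotency *)

Section LeftNilpotency.
Variables (A : finZmodType) (circ : A -> A -> A) (p n : nat).
Hypothesis brA : is_left_brace circ.
Hypotheses (p_pr : prime p) (cardA : #|A| = (p ^ n)%N).
Local Notation star := (star circ).

(** The ascending series of the action [lam]: level i + 1 is the preimage of the fixed points on the
    quotient of A by level i. *)
Fixpoint socle_series (j : nat) : {set A} :=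
  if j is i.+1 then [set x | [forall a, star a x \in socle_series i]]
  else [set 0].

Lemma socle_seriesP j x :
  reflect (forall a, star a x \in socle_series j) (x \in socle_series j.+1).
Proof. by rewrite inE; apply: forallP. Qed.

Lemma socle_series_group_set j : group_set (socle_series j).
Proof.
apply/group_setP; elim: j => [|j [h0 hD]] /=.
  split; first by rewrite inE.
  by move=> x y /set1P-> /set1P->; rewrite inE /= [(_ * _)%g]addr0.
split; first by apply/socle_seriesP=> a; rewrite star0.
move=> x y /socle_seriesP hx /socle_seriesP hy; apply/socle_seriesP=> a.
by rewrite [(x * y)%g]/(x + y) starD //; exact: hD.
Qed.
Canonical socle_series_group j := Group (socle_series_group_set j).

Lemma socle_series0 j : 0 \in socle_series j.
Proof. exact: (group1 (socle_series_group j)). Qed.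

Lemma socle_seriesD j x y :
  x \in socle_series j -> y \in socle_series j -> x + y \in socle_series j.
Proof. exact: (@groupM _ (socle_series_group j)). Qed.

Lemma socle_seriesN j x : x \in socle_series j -> - x \in socle_series j.
Proof. by move=> h; exact: (@groupVr _ (socle_series_group j)). Qed.

Lemma socle_seriesMn j x m : x \in socle_series j -> x *+ m \in socle_series j.
Proof. by move=> h; exact: (@groupX _ (socle_series_group j)). Qed.

Lemma socle_seriesS j x : x \in socle_series j -> x \in socle_series j.+1.
Proof.
elim: j x => [|j IH] x; first by move/set1P->; exact: socle_series0.
by move=> /socle_seriesP h; apply/socle_seriesP=> a; apply: IH.
Qed.

Lemma socle_seriesW i j x :
  (i <= j)%N -> x \in socle_series i -> x \in socle_series j.
Proof. by move/subnK <-; elim: (j - i)%N => // k IH /IH; apply: socle_seriesS. Qed.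

Lemma socle_series_lam j a x : x \in socle_series j -> lam circ a x \in socle_series j.
Proof.
move=> hx; rewrite lamE; apply: socle_seriesD => //.
by move/socle_seriesS/socle_seriesP: hx.
Qed.

Lemma socle_series_proper j :
  socle_series j != [set: A] -> socle_series j \proper socle_series j.+1.
Proof.
move=> neqT; rewrite properE; apply/andP; split.
  by apply/subsetP=> x; apply: socle_seriesS.
have pA : p.-nat #|A| by rewrite cardA pnatX pnat_id.
have pG : (p.-group [set: mult_group brA])%g by rewrite /pgroup cardsT.
case: (@pgroup_fix_quotient A _ (lam_action brA) p (socle_series_group j)) => //.
- by move=> g x y; exact: lamD.
- by move=> g x; exact: socle_series_lam.
move=> x nx hx; apply/subsetPn; exists x => //; apply/socle_seriesP=> a.
have := hx (a : mult_group brA)^-1%g.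
by rewrite /= /lam_act invgK starE.
Qed.

(** Levels are subgroups, so their orders are powers of p, and each strict inclusion raises the
    exponent. *)
Lemma socle_series_card j :
  socle_series j != [set: A] -> (p ^ j <= #|socle_series j|)%N.
Proof.
elim: j => [|j IH] neqT; first by rewrite cards1.
have neqT' : socle_series j != [set: A].
  apply: contra neqT => /eqP e; rewrite eqEsubset subsetT /=.
  by apply/subsetP=> x hx; apply: socle_seriesS; rewrite e.
have pw i : exists k, #|socle_series i| = (p ^ k)%N.
  have: (#|socle_series_group i| %| p ^ n)%N.
    by rewrite -cardA -cardsT; apply: cardSg; apply: subsetT.
  by case/(dvdn_pfactor _ _ p_pr)=> k _ e; exists k.
have := proper_card (socle_series_proper neqT'); have := IH neqT'.
have [[k ->] [l ->]] := (pw j, pw j.+1).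
by rewrite !leq_exp2l ?ltn_exp2l ?prime_gt1 // => /leq_ltn_trans h /h.
Qed.

Lemma socle_series_full : socle_series n = [set: A].
Proof.
apply/eqP; apply/negPn/negP=> neqT.
have := proper_card (socle_series_proper neqT).
apply/negP; rewrite -leqNgt; apply: leq_trans (socle_series_card neqT).
by rewrite -cardA max_card.
Qed.

End LeftNilpotency.

(** * Finite differences *)

Section Newton.
Variable A : zmodType.
Implicit Types f : nat -> A.

Definition fdiff f (m : nat) : A := f m.+1 - f m.

(** Newton's forward difference formula, by Pascal's rule. The upper bound N is free because the
    binomials vanish for k > s. *)
Lemma newton f s N : (s < N)%N ->
  f s = \sum_(k < N) iter k fdiff f 0%N *+ 'C(s, k).
Proof.
elim: s f N => [|s IH] f [|N] // ltsN.
  by rewrite big_ord_recl bin0 mulr1n big1 ?addr0 // => i _; rewrite lift0 bin0n.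
have -> : f s.+1 = f s + fdiff f s by rewrite addrC subrK.
rewrite (IH f N.+1) ?(ltnW ltsN) // (IH (fdiff f) N) //.
rewrite [X in X + _]big_ord_recl [RHS]big_ord_recl !bin0 -addrA -big_split.
congr (_ + _); apply: eq_bigr => i _.
by rewrite !lift0 -iterSr binS mulrnDr.
Qed.

Lemma eq_iter_fdiff k f g : f =1 g -> iter k fdiff f =1 iter k fdiff g.
Proof. by move=> e; elim: k => //= k IH m; rewrite /fdiff !IH. Qed.

End Newton.

(** * The filtration of A by the subgroups p^i A *)

Section PMultiples.
Variables (A : zmodType) (p : nat).

Definition pmul (i : nat) (x : A) : Prop := exists y, x = y *+ p ^ i.

Lemma pmul_all x : pmul 0 x. Proof. by exists x. Qed.

Lemma pmul0 i : pmul i 0. Proof. by exists 0; rewrite mul0rn. Qed.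

Lemma pmulD i x y : pmul i x -> pmul i y -> pmul i (x + y).
Proof. by case=> u -> [v ->]; exists (u + v); rewrite mulrnDl. Qed.

Lemma pmulN i x : pmul i x -> pmul i (- x).
Proof. by case=> u ->; exists (- u); rewrite mulNrn. Qed.

Lemma pmulMn i x m : pmul i x -> pmul i (x *+ m).
Proof. by case=> u ->; exists (u *+ m); rewrite mulrnAC. Qed.

Lemma pmul_exp i j x : pmul i x -> pmul (i + j) (x *+ p ^ j).
Proof. by case=> u ->; exists u; rewrite -mulrnA expnD. Qed.

Lemma pmulW i j x : (j <= i)%N -> pmul i x -> pmul j x.
Proof.
move=> le_ji [u ->]; exists (u *+ p ^ (i - j)).
by rewrite -mulrnA -expnD subnK.
Qed.

Lemma pmul_sum i I (r : seq I) (P : pred I) (F : I -> A) :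
  (forall k, P k -> pmul i (F k)) -> pmul i (\sum_(k <- r | P k) F k).
Proof. by move=> h; elim/big_ind: _ => //; [apply: pmul0 | apply: pmulD]. Qed.

End PMultiples.

(** * Compatibility of [star] with the filtration *)

Section PFiltration.
Variables (A : finZmodType) (circ : A -> A -> A) (p n : nat).
Hypothesis brA : is_left_brace circ.
Hypotheses (p_pr : prime p) (cardA : #|A| = (p ^ n)%N) (lt_np : (n.+1 < p)%N).
Local Notation star := (star circ).
Local Notation lam := (lam circ).
Local Notation socle_series := (socle_series circ).

Lemma iter_star_socle j k w x :
  x \in socle_series j -> iter k (star w) x \in socle_series (j - k).
Proof.
move=> hx; elim: k => [|k IH]; first by rewrite subn0.
rewrite subnS iterS; case: (j - k)%N IH => [|i]; last by move/socle_seriesP.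
by move/set1P->; rewrite star0 //; apply: (socle_series0 brA).
Qed.

(** Each application of [star w] descends one level of the socle series, whose level n is all of
    A. *)
Lemma iter_star_nil k w x : (n <= k)%N -> iter k (star w) x = 0.
Proof.
move=> lenk; have: iter k (star w) x \in socle_series (n - k).
  by apply: iter_star_socle; rewrite (socle_series_full brA p_pr cardA) inE.
by rewrite (eqP (lenk : n - k == 0)%N) => /set1P.
Qed.

Lemma iter_fdiff_lam w u k s :
  iter k (@fdiff A) (fun m => iter m (lam w) u) s = iter k (star w) (iter s (lam w) u).
Proof.
elim: k s => [|k IH] s //=.
rewrite {1}/fdiff !IH [RHS]starE; congr (_ - _).
by elim: k {IH} => //= k ->; rewrite !starE lamB.
Qed.

Lemma iter_lam w u m :
  iter m (lam w) u = \sum_(k < m.+1) iter k (star w) u *+ 'C(m, k).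
Proof.
rewrite (newton (fun m => iter m (lam w) u) (ltnSn m)).
by apply: eq_bigr => k _; rewrite iter_fdiff_lam.
Qed.

Definition cpow (w : A) (m : nat) : A := iter m (circ w) 0.

Lemma lam_cpow w m u : lam (cpow w m) u = iter m (lam w) u.
Proof.
elim: m => [|m IH]; first exact: lam0l.
by rewrite /cpow iterS lam_circ // -/(cpow w m) IH.
Qed.

Lemma cpowSr w m : cpow w m.+1 = circ (cpow w m) w.
Proof.
elim: m => [|m IH]; first by rewrite /cpow /= circ0 // circ0l.
by rewrite [LHS]iterS -/(cpow w m.+1) {1}IH (circA brA).
Qed.

(** The difference of m |-> w^m is lam_w^m w, whose further differences are iterates of [star w];
    Newton's formula applies. *)
Lemma cpowE w m : cpow w m = \sum_(k < m) iter k (star w) w *+ 'C(m, k.+1).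
Proof.
rewrite (newton (cpow w) (ltnSn m)) big_ord_recl bin0 mulr1n add0r.
apply: eq_bigr => k _; rewrite lift0; congr (_ *+ _).
rewrite iterSr -[RHS](iter_fdiff_lam w w k 0).
apply: eq_iter_fdiff => j.
by rewrite /fdiff cpowSr (circE circ) addrC addKr lam_cpow.
Qed.

(** In the binomial expansion of lam_w^p - 1 the terms with 0 < k < p gain a factor p from the
    binomial, and the term k = p vanishes by nilpotency. *)
Lemma star_cpow w i :
  (forall u, pmul p i (star w u)) -> forall u, pmul p i.+1 (star (cpow w p) u).
Proof.
move=> hw u; rewrite starE lam_cpow iter_lam big_ord_recl bin0 mulr1n.
rewrite addrC addKr; apply: pmul_sum => k _; rewrite lift0.
have [ltkp|] := ltnP k.+1 p; last first.
  by move=> lepk; rewrite iter_star_nil ?mul0rn; [apply: pmul0 | lia].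
have /dvdnP[c ->] := prime_dvd_bin p_pr (ltkp : 0 < k.+1 < p)%N.
by rewrite mulrnA -addn1; apply: (pmul_exp 1); apply: pmulMn; apply: hw.
Qed.

(* Induction on the socle series peels off p-th powers: the p-th power of
   w = p^i y in (A, circ) is p^(i+1) y up to p^(i+1) times an element one step
   lower in the series. *)
Lemma pmul_cpow_ind (P : A -> Prop) i :
  P 0 -> (forall a b, P a -> P b -> P (circ a b)) ->
  (forall y, P (cpow (y *+ p ^ i) p)) -> forall y, P (y *+ p ^ i.+1).
Proof.
move=> P0 PM Pp y; have : y \in socle_series n.
  by rewrite (socle_series_full brA p_pr cardA) inE.
elim: {1}n y => [|j IH] y; first by move/set1P->; rewrite mul0rn.
move=> hy; set w := y *+ p ^ i.
have [r hr e] : exists2 r, r \in socle_series j & cpow w p = (y + r) *+ p ^ i.+1.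
  have [m ep] : exists m, p = m.+2 by case: p lt_np => [|[|m]] // _; exists m.
  have itw k : iter k (star w) w = iter k (star w) y *+ p ^ i.
    by elim: k => //= k ->; rewrite starMn.
  (* In [cpowE] the first term is p w, the last one vanishes by nilpotency, and the middle ones,
     divided by p^(i+1), make up r. *)
  exists (\sum_(k < m) iter k.+1 (star w) y *+ ('C(p, k.+2) %/ p)).
    elim/big_ind: _ => [||k _]; first exact: (socle_series0 brA).
      exact: (socle_seriesD brA).
    apply: (socle_seriesMn brA); apply: (socle_seriesW brA (leq_subr k j)).
    exact: (@iter_star_socle j.+1 k.+1).
  have -> : cpow w p = cpow w m.+2 by rewrite -ep.
  rewrite cpowE big_ord_recl big_ord_recr /= /bump /=.
  rewrite add0n add1n -!ep bin1 binn mulr1n -/(iter m.+1 (star w) w).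
  rewrite iter_star_nil; last by lia.
  rewrite addr0 mulrnDl -mulrnA expnS [(p * _)%N]mulnC; congr (_ + _).
  rewrite -sumrMnl; apply: eq_bigr => k _.
  rewrite add0n add1n itw starMn // -!mulrnA.
  have /divnK eC : (p %| 'C(p, k.+2))%N by apply: prime_dvd_bin; have := ltn_ord k; lia.
  by rewrite -{1}eC; congr (_ *+ _); lia.
(* Solves e for p^(i+1) y inside (A, o); the correcting factor stays in level j since levels are
   stable under [lam]. *)
have -> : y *+ p ^ i.+1 = circ (cpow w p) (- lam (cinv brA (cpow w p)) r *+ p ^ i.+1).
  by rewrite (circE circ) lamMn // lamN // lamKV e mulrnDl mulNrn addrK.
apply: PM; [exact: Pp | apply: IH].
by apply: (socle_seriesN brA); apply: (socle_series_lam brA).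
Qed.

Lemma star_pmul_base i y u : pmul p i (star (y *+ p ^ i) u).
Proof.
elim: i y u => [|i IH] y u; first exact: pmul_all.
move: y u; apply: (@pmul_cpow_ind (fun a => forall u, pmul p i.+1 (star a u)));
  [move=> u|move=> a b ha hb u|move=> y].
- by rewrite star0l //; apply: pmul0.
- by rewrite star_circ //; apply: pmulD => //; apply: pmulD.
by apply: star_cpow; apply: IH.
Qed.

(** Again it suffices to treat p-th powers for [circ]: the binomials supply a factor p, and the
    iterates of [star w] on u are still killed by p. *)
Lemma star_ann a u : pmul p 1 a -> u *+ p = 0 -> star a u = 0.
Proof.
case=> y ->; move: y u.
apply: (@pmul_cpow_ind (fun a => forall u, u *+ p = 0 -> star a u = 0) 0);
  [move=> u _|move=> a' b ha hb u pu|move=> y u pu].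
- exact: star0l.
- by rewrite star_circ // ha // hb // star0 // !addr0.
set w := y *+ _; rewrite starE lam_cpow iter_lam big_ord_recl bin0 mulr1n.
rewrite addrC addKr big1 // => k _; rewrite lift0.
have [ltkp|lepk] := ltnP k.+1 p; last by rewrite iter_star_nil ?mul0rn //; lia.
have /dvdnP[c ->] := prime_dvd_bin p_pr (ltkp : 0 < k.+1 < p)%N.
rewrite mulrnA mulrnAC; suff -> : iter k.+1 (star w) u *+ p = 0 by rewrite mul0rn.
elim: k.+1 => //= l IH; by rewrite -starMn // IH star0.
Qed.

Lemma star_pmul i j x u : pmul p i x -> pmul p j u -> pmul p (i + j) (star x u).
Proof.
move=> [y ->] [v ->]; rewrite starMn //; apply: pmul_exp.
exact: star_pmul_base.
Qed.

Lemma pmul_nil i (x : A) : (n <= i)%N -> pmul p i x -> x = 0.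
Proof.
move=> leni [y ->]; rewrite -(subnKC leni) expnD mulrnA -cardA.
have -> : y *+ #|A| = 0; last by rewrite mul0rn.
by apply/eqP; rewrite -[_ *+ _]/(y ^+ #|A|)%g -order_dvdn -cardsT order_dvdG ?inE.
Qed.

End PFiltration.

(** * p-analytic functions *)

Section PAnalytic.
Variables (A : zmodType) (p : nat) (X I : Type) (sh : I -> X -> X).
Implicit Types f g : X -> A.
Local Notation pmul := (pmul p).

(* m shifts the filtration: differences of order j <= k lie in p^(m+j) A. *)
Fixpoint panalytic_upto (k m : nat) (f : X -> A) : Prop :=
  (forall x, pmul m (f x)) /\
  (if k is l.+1
   then forall i, panalytic_upto l m.+1 (fun x => f (sh i x) - f x) else True).

Definition panalytic m f := forall k, panalytic_upto k m f.

Lemma panalytic_upto_ext k m f g :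
  f =1 g -> panalytic_upto k m f -> panalytic_upto k m g.
Proof.
elim: k m f g => [|k IH] m f g e [h1 h2]; split=> //; try by move=> x; rewrite -e.
by move=> i; apply: IH (h2 i) => x; rewrite !e.
Qed.

Lemma panalytic_uptoS k m f : panalytic_upto k.+1 m f -> panalytic_upto k m f.
Proof.
elim: k m f => [|k IH] m f [h1 h2]; split=> // i.
by apply: IH; apply: h2.
Qed.

Lemma panalytic_uptoW k m n f :
  (n <= m)%N -> panalytic_upto k m f -> panalytic_upto k n f.
Proof.
elim: k m n f => [|k IH] m n f le_nm [h1 h2]; split=> //;
  try by move=> x; exact: pmulW le_nm (h1 x).
by move=> i; apply: IH (h2 i).
Qed.

Lemma panalytic_uptoD k m f g : panalytic_upto k m f -> panalytic_upto k m g ->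
  panalytic_upto k m (fun x => f x + g x).
Proof.
elim: k m f g => [|k IH] m f g [f1 f2] [g1 g2]; split=> //; try by move=> x; exact: pmulD.
move=> i; apply: panalytic_upto_ext (IH _ _ _ (f2 i) (g2 i)) => x.
by rewrite opprD addrACA.
Qed.

Lemma panalytic_uptoN k m f : panalytic_upto k m f ->
  panalytic_upto k m (fun x => - f x).
Proof.
elim: k m f => [|k IH] m f [f1 f2]; split=> //; try by move=> x; exact: pmulN.
move=> i; apply: panalytic_upto_ext (IH _ _ (f2 i)) => x.
by rewrite opprD.
Qed.

Lemma panalytic_upto0 k m : panalytic_upto k m (fun=> 0).
Proof.
elim: k m => [|k IH] m; split=> //; try by move=> x; exact: pmul0.
by move=> i; apply: panalytic_upto_ext (IH m.+1) => x; rewrite subrr.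
Qed.

Lemma panalytic_upto_shift k m f i : panalytic_upto k.+1 m f ->
  panalytic_upto k m (fun x => f (sh i x)).
Proof.
move=> hf; have h2 := panalytic_uptoS hf; case: hf => _ /(_ i) h.
have h1 := panalytic_uptoW (leqnSn m) h.
by apply: panalytic_upto_ext (panalytic_uptoD h1 h2) => x; rewrite subrK.
Qed.

Lemma panalytic_val m f x : panalytic m f -> pmul m (f x).
Proof. by move/(_ 0%N)=> []. Qed.

Lemma panalytic_diff m f i :
  panalytic m f -> panalytic m.+1 (fun x => f (sh i x) - f x).
Proof. by move=> hf k; case: (hf k.+1) => _; apply. Qed.

Lemma panalytic_ext m f g : f =1 g -> panalytic m f -> panalytic m g.
Proof. by move=> e hf k; apply: panalytic_upto_ext e (hf k). Qed.

Lemma panalyticD m f g :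
  panalytic m f -> panalytic m g -> panalytic m (fun x => f x + g x).
Proof. by move=> hf hg k; apply: panalytic_uptoD. Qed.

Lemma panalytic_sum m J (r : seq J) (F : J -> X -> A) :
  (forall j, panalytic m (F j)) -> panalytic m (fun x => \sum_(j <- r) F j x).
Proof.
move=> hF; elim: r => [|j r IH].
  by move=> k; apply: panalytic_upto_ext (panalytic_upto0 k m) => x; rewrite big_nil.
by apply: panalytic_ext (panalyticD (hF j) IH) => x; rewrite big_cons.
Qed.

Lemma panalyticMn m f c : panalytic m f -> panalytic m (fun x => f x *+ c).
Proof.
move=> hf; elim: c => [|c IH]; first by move=> k; apply: panalytic_upto0.
by apply: panalytic_ext (panalyticD hf IH) => x; rewrite mulrS.
Qed.

Lemma panalytic_const m a : pmul m a -> panalytic m (fun=> a).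
Proof.
move=> ha [|k]; split=> // i; apply: panalytic_upto_ext (panalytic_upto0 k m.+1) => x.
by rewrite subrr.
Qed.

Lemma panalytic_affine f (d : I -> A) : (forall i, pmul 1 (d i)) ->
  (forall i x, f (sh i x) = f x + d i) -> panalytic 0 f.
Proof.
move=> hd hf [|k]; split=> //; try by move=> x; exact: pmul_all.
by move=> i; apply: panalytic_upto_ext (panalytic_const (hd i) k) => x;
  rewrite hf addrC addKr.
Qed.

End PAnalytic.

(** * Stability of p-analytic functions under [star] and [lam] *)

Section StarPAnalytic.
Variables (A : zmodType) (circ : A -> A -> A) (p : nat).
Variables (X I : Type) (sh : I -> X -> X).
Hypothesis brA : is_left_brace circ.
Hypothesis star_pmul :
  forall i j x u, pmul p i x -> pmul p j u -> pmul p (i + j) (star circ x u).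
Local Notation lam := (lam circ).
Local Notation star := (star circ).
Local Notation cinv := (cinv brA).

(** The two claims need a joint induction on k: by [lamDl], a difference of [lam] involves both
    [star] and the inverse of [lam]. *)
Lemma panalytic_upto_star_lamV k :
  (forall i j f u, panalytic_upto p sh k i f -> panalytic_upto p sh k j u ->
     panalytic_upto p sh k (i + j) (fun x => star (f x) (u x))) /\
  (forall j f u, panalytic_upto p sh k 0 f -> panalytic_upto p sh k j u ->
     panalytic_upto p sh k j (fun x => lam (cinv (f x)) (u x))).
Proof.
have pmul_lam i a u : pmul p i u -> pmul p i (lam a u).
  move=> hu; rewrite lamE; apply: pmulD => //.
  by apply: (@star_pmul 0) => //; apply: pmul_all.
elim: k => [|k [IHs IHv]].
  by split=> [i j f u [f1 _] [u1 _]|j f u _ [u1 _]]; split=> // x; auto.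
have IHl i f u : panalytic_upto p sh k 0 f -> panalytic_upto p sh k i u ->
    panalytic_upto p sh k i (fun x => lam (f x) (u x)).
  move=> hf hu; apply: panalytic_upto_ext (panalytic_uptoD (IHs 0 i _ _ hf hu) hu).
  by move=> x; rewrite -lamE.
(* The increment of x |-> lam (f x) is again a composition of maps covered by
   the induction hypothesis, see lamDl. *)
have diff_lam i j f u e : panalytic_upto p sh k.+1 i f -> panalytic_upto p sh k j u ->
    panalytic_upto p sh k (i + j).+1 (fun x => lam (f (sh e x)) (u x) - lam (f x) (u x)).
  move=> hf hu; have hf0 := panalytic_uptoW (leq0n i) (panalytic_uptoS hf).
  case: hf => _ /(_ e) hd.
  apply: panalytic_upto_ext (IHl _ _ _ hf0 (IHs _ _ _ _ (IHv _ _ _ hf0 hd) hu)) => x /=.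
  rewrite -[in RHS](subrK (f x) (f (sh e x))) [_ - _ + f x]addrC (lamDl brA).
  by rewrite [RHS]addrC addKr.
split=> [i j f u hf hu|j f u hf hu].
  split=> [x|e]; first by apply: star_pmul; [case: hf|case: hu].
  have hSf := panalytic_upto_shift e hf.
  have hd := diff_lam i j f u e hf (panalytic_uptoS hu).
  case: hu => _ /(_ e) hdu.
  (* Product rule, with f' the shifted f and du the difference of u: the difference of star f u is
     star f' du + (lam_f' - lam_f) u. *)
  have := panalytic_uptoD (IHs _ _ _ _ hSf hdu); rewrite addnS => /(_ _ hd).
  apply: panalytic_upto_ext => x.
  rewrite starB // ![star _ (u x)]starE -addrA; congr (_ + _).
  by rewrite !opprB addrA subrK.
split=> [x|e]; first by apply: pmul_lam; case: hu.
have hSf := panalytic_upto_shift e hf; have hf0 := panalytic_uptoS hf.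
have hu0 := panalytic_uptoS hu.
have hd := diff_lam 0 j f (fun x => lam (cinv (f x)) (u x)) e hf (IHv _ _ _ hf0 hu0).
case: hu => _ /(_ e) hdu.
(* Rule for inverses: the difference of lam_f^-1 u is lam_f'^-1 du - lam_f'^-1 (lam_f' - lam_f)
   lam_f^-1 u. *)
have := panalytic_uptoD (IHv _ _ _ hSf hdu) (panalytic_uptoN (IHv _ _ _ hSf hd)).
apply: panalytic_upto_ext => x.
by rewrite -lamB // lamKV // opprB addrA subrK lamB // lamK.
Qed.

Lemma panalytic_star i j f u : panalytic p sh i f -> panalytic p sh j u ->
  panalytic p sh (i + j) (fun x => star (f x) (u x)).
Proof. by move=> hf hu k; apply: (panalytic_upto_star_lamV k).1. Qed.

Lemma panalytic_lamV j f u : panalytic p sh 0 f -> panalytic p sh j u ->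
  panalytic p sh j (fun x => lam (cinv (f x)) (u x)).
Proof. by move=> hf hu k; apply: (panalytic_upto_star_lamV k).2. Qed.

Lemma panalytic_lam j f u : panalytic p sh 0 f -> panalytic p sh j u ->
  panalytic p sh j (fun x => lam (f x) (u x)).
Proof.
move=> hf hu; apply: panalytic_ext (panalyticD (panalytic_star hf hu) hu) => x.
by rewrite [RHS]lamE.
Qed.

End StarPAnalytic.

(** * A as a module over Z/q *)

Section Scalars.
Variables (A : zmodType) (q : nat).
Hypotheses (q_gt1 : (1 < q)%N) (mulrn_q : forall x : A, x *+ q = 0).

Definition sc (r : 'Z_q) (x : A) : A := x *+ (r : nat).

Lemma mulrn_modq (x : A) m : x *+ (m %% q) = x *+ m.
Proof.
by rewrite [in RHS](divn_eq m q) mulrnDr mulnC mulrnA mulrn_q mul0rn add0r.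
Qed.

Lemma sc_nat m x : sc m%:R x = x *+ m.
Proof. by rewrite /sc val_Zp_nat // mulrn_modq. Qed.

Lemma scDl r s x : sc (r + s) x = sc r x + sc s x.
Proof. by rewrite -[r]natr_Zp -[s]natr_Zp -natrD !sc_nat mulrnDr. Qed.

Lemma scM r s x : sc (r * s) x = sc r (sc s x).
Proof. by rewrite -[r]natr_Zp -[s]natr_Zp -natrM !sc_nat mulnC mulrnA. Qed.

Lemma sc0l x : sc 0 x = 0. Proof. exact: mulr0n. Qed.
Lemma sc1 x : sc 1 x = x. Proof. exact: (sc_nat 1). Qed.
Lemma sc0 r : sc r 0 = 0. Proof. exact: mul0rn. Qed.
Lemma scD r x y : sc r (x + y) = sc r x + sc r y. Proof. exact: mulrnDl. Qed.
Lemma scN r x : sc r (- x) = - sc r x. Proof. exact: mulNrn. Qed.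

Lemma scMn r x m : sc r (x *+ m) = sc r x *+ m.
Proof. by rewrite /sc mulrnAC. Qed.

Lemma sc_suml I (r : seq I) (P : pred I) (F : I -> 'Z_q) x :
  sc (\sum_(i <- r | P i) F i) x = \sum_(i <- r | P i) sc (F i) x.
Proof. exact: (big_morph (sc^~ x) (fun r s => scDl r s x) (sc0l x)). Qed.

Lemma sc_sum I (r : seq I) (P : pred I) a (F : I -> A) :
  sc a (\sum_(i <- r | P i) F i) = \sum_(i <- r | P i) sc a (F i).
Proof. exact: (big_morph (sc a) (scD a) (sc0 a)). Qed.

End Scalars.

(** * Extraction of coefficients by roots of unity *)

Definition shiftn (_ : unit) : nat -> nat := S.
Definition shiftn2 (b : bool) (x : nat * nat) : nat * nat :=
  if b then (x.1.+1, x.2) else (x.1, x.2.+1).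

Section Coefficients.
Variables (A : zmodType) (p n xi : nat).
Hypotheses (p_pr : prime p) (lt_np : (n.+1 < p)%N).
Hypothesis pmul_nil : forall i (x : A), (n <= i)%N -> pmul p i x -> x = 0.
Local Notation q := (p ^ p)%N.
Local Notation zeta := (xi%:R : 'Z_q).
Hypothesis zeta_exp : zeta ^+ p.-1 = 1.
Hypothesis zeta_unit :
  forall d, (0 < d < p.-1)%N -> zeta ^+ d - 1 \is a GRing.unit.
Local Notation sc := (@sc A q).
Local Notation pmul := (pmul p).
Local Notation panalytic := (panalytic p shiftn).

Lemma q_gt1 : (1 < q)%N.
Proof. by rewrite -{1}(exp1n p) ltn_exp2r ?prime_gt1 ?prime_gt0. Qed.

Lemma mulrn_q (x : A) : x *+ q = 0.
Proof. by apply: (@pmul_nil p); [lia | exists x]. Qed.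

Lemma natr_unit k : (0 < k < p)%N -> (k%:R : 'Z_q) \is a GRing.unit.
Proof.
move=> /andP[k0 ltkp]; rewrite unitZpE ?q_gt1 // coprimeXl // prime_coprime //.
by rewrite gtnNdvd.
Qed.

(* The j-th coefficient of f, viewed as a polynomial of degree < p - 1, obtained
   as a Fourier coefficient over the (p-1)-th roots of unity xi^t. The integer
   (p - 1 - j) t stands for the exponent - j t. *)
Definition fcoef (j : nat) (f : nat -> A) : A :=
  \sum_(t < p.-1) sc ((p.-1%:R)^-1 * zeta ^+ ((p.-1 - j) * t)) (f (xi ^ t)%N).

Lemma eq_coef j f g : f =1 g -> fcoef j f = fcoef j g.
Proof. by move=> e; apply: eq_bigr => t _; rewrite e. Qed.

Lemma fcoefD j f g : fcoef j (fun s => f s + g s) = fcoef j f + fcoef j g.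
Proof. by rewrite -big_split; apply: eq_bigr => t _; rewrite scD. Qed.

Lemma fcoef_sum j I (r : seq I) (P : pred I) (F : I -> nat -> A) :
  fcoef j (fun s => \sum_(i <- r | P i) F i s) = \sum_(i <- r | P i) fcoef j (F i).
Proof. by rewrite exchange_big; apply: eq_bigr => t _; rewrite sc_sum. Qed.

Lemma fcoefMn j f m : fcoef j (fun s => f s *+ m) = fcoef j f *+ m.
Proof. by rewrite -sumrMnl; apply: eq_bigr => t _; rewrite scMn. Qed.

Lemma fcoefC (f : nat -> nat -> A) i j :
  fcoef i (fun s => fcoef j (f s)) = fcoef j (fun t => fcoef i (f^~ t)).
Proof.
rewrite /fcoef; under eq_bigr do rewrite sc_sum.
rewrite exchange_big; apply: eq_bigr => t _; rewrite sc_sum.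
by apply: eq_bigr => s _; rewrite -!(scM q_gt1 mulrn_q) mulrC.
Qed.

(** For distinct i and j this is a geometric sum of ratio zeta^d with 0 < d < p - 1. Times zeta^d -
    1 it is 0, and that factor is a unit, which matters as ['Z_q] may have zero divisors. *)
Lemma zeta_orthogonality i j : (i < p.-1)%N -> (j < p.-1)%N ->
  \sum_(t < p.-1) zeta ^+ ((p.-1 - j) * t) * zeta ^+ (i * t)
  = if i == j then p.-1%:R else 0.
Proof.
move=> lti ltj; pose m := (p.-1 - j + i)%N.
rewrite (eq_bigr (fun t : 'I__ => (zeta ^+ m) ^+ t)); last first.
  by move=> t _; rewrite -exprD -exprM mulnDl.
case: eqP => [eij|neij].
  have -> : m = p.-1 by rewrite /m eij subnK // ltnW.
  by rewrite zeta_exp; under eq_bigr do rewrite expr1n; rewrite sumr_const card_ord.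
have [d [hd ->]] : exists d, (0 < d < p.-1)%N /\ zeta ^+ m = zeta ^+ d.
  have [ltij|leji] := ltnP i j; first by exists m; split=> //; lia.
  exists (i - j)%N; split; first by lia.
  have -> : m = (p.-1 + (i - j))%N by rewrite /m; lia.
  by rewrite exprD zeta_exp mul1r.
apply: (mulrI (zeta_unit hd)); rewrite mulr0 -subrX1 -exprM mulnC exprM zeta_exp.
by rewrite expr1n subrr.
Qed.

Lemma fcoef_monomial i j x : (i < p.-1)%N -> (j < p.-1)%N ->
  fcoef j (fun s => x *+ s ^ i) = if i == j then x else 0.
Proof.
move=> lti ltj; rewrite /fcoef.
rewrite (eq_bigr (fun t : 'I__ =>
  sc ((p.-1%:R)^-1 * (zeta ^+ ((p.-1 - j) * t) * zeta ^+ (i * t))) x)); last first.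
  move=> t _; rewrite mulrA [RHS](scM q_gt1 mulrn_q).
  congr (sc _ _); rewrite -natrX (sc_nat q_gt1 mulrn_q).
  by rewrite mulnC expnM.
rewrite -(sc_suml q_gt1 mulrn_q).
rewrite -mulr_sumr zeta_orthogonality //.
case: eqP => _; last by rewrite mulr0 sc0l.
rewrite mulVr ?(sc1 q_gt1 mulrn_q) //.
by apply: natr_unit; lia.
Qed.

(* No bound on [i] is needed: beyond the nilpotency degree x vanishes. *)
Lemma fcoef_pmul_monomial i j x : (j < p.-1)%N -> pmul i x ->
  fcoef j (fun s => x *+ s ^ i) = if i == j then x else 0.
Proof.
move=> ltj hx; have [lti|lei] := ltnP i p.-1; first exact: fcoef_monomial.
have -> : x = 0 by apply: pmul_nil hx; lia.
rewrite if_same /fcoef big1 // => t _.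
by rewrite mul0rn sc0.
Qed.

(** The binomial coefficient (s choose k) as a polynomial in s; for k < p the factorial is
    invertible in ['Z_q]. *)
Definition binom_poly (k : nat) : {poly 'Z_q} :=
  (k`!%:R)^-1 *: \prod_(i < k) ('X - i%:R%:P).

Lemma size_binom_poly k : (size (binom_poly k) <= k.+1)%N.
Proof.
apply: leq_trans (size_scale_leq _ _) _.
by rewrite size_prod_XsubC /index_enum -enumT size_enum_ord.
Qed.

Lemma horner_binom_poly k s : (k < p)%N -> (binom_poly k).[s%:R] = 'C(s, k)%:R.
Proof.
move=> ltkp; rewrite hornerZ.
have -> : (\prod_(i < k) ('X - i%:R%:P : {poly 'Z_q})).[s%:R] = (s ^_ k)%:R.
  elim: k {ltkp} => [|k IH]; first by rewrite big_ord0 hornerE ffactn0.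
  rewrite big_ord_recr hornerM IH !hornerE ffactnSr natrM.
  have [leks|ltsk] := leqP k s; first by rewrite natrB.
  by rewrite ffact_small // !mul0r.
have fU : (k`!%:R : 'Z_q) \is a GRing.unit.
  elim: k ltkp => [|k IH] ltkp; first by rewrite unitr1.
  by rewrite factS natrM unitrM natr_unit ?IH // ltnW.
by rewrite -bin_ffact natrM mulrC mulrK.
Qed.

Lemma panalytic_newton m (f : nat -> A) k :
  panalytic m f -> pmul (m + k) (iter k (@fdiff A) f 0%N).
Proof.
elim: k m f => [|k IH] m f hf; first by rewrite addn0; apply: panalytic_val hf.
by rewrite iterSr -addSnnS; apply: IH; apply: (panalytic_diff tt hf).
Qed.

(** Rewrites the Newton series in powers of s. Terms with k >= p - 1 > n vanish since they lie in
    p^k A; the coefficient of s^i only receives terms with k >= i, all in p^(m+i) A. *)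
Lemma panalytic_expansion m (f : nat -> A) : panalytic m f ->
  exists C : nat -> A, (forall i, pmul (m + i) (C i)) /\
    (forall s, f s = \sum_(i < p.-1) C i *+ s ^ i).
Proof.
move=> hf; pose b k := iter k (@fdiff A) f 0%N.
have hb k : pmul (m + k) (b k) by apply: panalytic_newton.
exists (fun i => \sum_(k < p.-1) sc (binom_poly k)`_i (b k)); split=> [i|s].
  apply: pmul_sum => k _; have [leik|ltki] := leqP i k.
    by apply: pmulMn; apply: pmulW (hb k); lia.
  rewrite nth_default ?sc0l; first exact: pmul0.
  exact: leq_trans (size_binom_poly k) ltki.
(* The bound s + p exceeds s, as [newton] requires, and p - 1, so that the sum can be cut there. *)
rewrite (@newton _ f s (s + p)); last by have := prime_gt0 p_pr; lia.
rewrite (bigID (fun k : 'I__ => k < p.-1)%N) /= [X in _ + X]big1 ?addr0; last first.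
  move=> k; rewrite -leqNgt => lek; rewrite -/(b k) (_ : b k = 0) ?mul0rn //.
  by apply: pmul_nil (hb k); lia.
rewrite -(big_ord_widen _ (fun k => b k *+ 'C(s, k))); last by lia.
under [RHS]eq_bigr do rewrite -sumrMnl.
rewrite exchange_big; apply: eq_bigr => k _.
have mq := mulrn_q; have q1 := q_gt1.
rewrite -(sc_nat q1 mq) -horner_binom_poly; last by have := ltn_ord k; lia.
have szk : (size (binom_poly k) <= p.-1)%N by apply: leq_trans (size_binom_poly k) _.
rewrite (horner_coef_wide _ szk) (sc_suml q1 mq); apply: eq_bigr => i _.
by rewrite mulrC (scM q1 mq) -natrX (sc_nat q1 mq).
Qed.

Lemma fcoef_expansion j (f C : nat -> A) : (j < p.-1)%N ->
  (forall s, f s = \sum_(i < p.-1) C i *+ s ^ i) -> fcoef j f = C j.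
Proof.
move=> ltj hf; rewrite (eq_coef _ hf) fcoef_sum (bigD1 (Ordinal ltj)) //=.
rewrite fcoef_monomial // eqxx big1 ?addr0 // => i neij.
by rewrite fcoef_monomial // ifN.
Qed.

Lemma fcoef_panalytic m j f : (j < p.-1)%N -> panalytic m f -> pmul (m + j) (fcoef j f).
Proof.
by move=> ltj /panalytic_expansion[C [hC eC]]; rewrite (fcoef_expansion ltj eC).
Qed.

Lemma panalytic_coefE m f s : panalytic m f ->
  f s = \sum_(j < p.-1) fcoef j f *+ s ^ j.
Proof.
move=> /panalytic_expansion[C [hC eC]]; rewrite eC; apply: eq_bigr => j _.
by rewrite (fcoef_expansion _ eC).
Qed.

Lemma fcoef0_panalytic m f : panalytic m f -> fcoef 0 f = f 0%N.
Proof.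
move=> hf; have [r er] : exists r, p.-1 = r.+1 by exists p.-2; lia.
rewrite (panalytic_coefE 0 hf) er big_ord_recl mulr1n big1 ?addr0 // => i _.
by rewrite lift0 exp0n // mulr0n.
Qed.

(** Coefficient i of g moves to degree i + j, so only i + j = 1 counts. Exponents matter only modulo
    p - 1 for [fcoef], but degrees from p - 1 on cannot interfere: their coefficients lie in p^(i+j)
    A = 0. *)
Lemma fcoef1_mulXn j g : (1 < p.-1)%N -> panalytic j g ->
  fcoef 1 (fun s => g s *+ s ^ j) =
    if j == 0%N then fcoef 1 g else if j == 1%N then g 0%N else 0.
Proof.
move=> p1 hg; case: eqP => [->|/eqP j0]; first exact: eq_coef.
rewrite (@eq_coef _ _ (fun s => \sum_(i < p.-1) fcoef i g *+ s ^ (i + j))); last first.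
  move=> s; rewrite {1}(panalytic_coefE s hg) -sumrMnl; apply: eq_bigr => i _.
  by rewrite -mulrnA expnD.
rewrite fcoef_sum (eq_bigr (fun i : 'I__ =>
   if (i + j == 1)%N then fcoef i g else 0)); last first.
  by move=> i _; apply: fcoef_pmul_monomial => //; rewrite addnC; apply: fcoef_panalytic.
have [r er] : exists r, p.-1 = r.+1 by exists p.-2; lia.
rewrite er big_ord_recl big1 ?addr0 ?add0n; last first.
  by move=> i _; rewrite lift0; case: eqP => //; lia.
by rewrite (fcoef0_panalytic hg).
Qed.

End Coefficients.

(** * Restriction from two variables to one *)

Section Slices.
Variables (A : zmodType) (p : nat).

Lemma panalytic_slice m (f : nat * nat -> A) t :
  panalytic p shiftn2 m f -> panalytic p shiftn m (fun s => f (s, t)).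
Proof.
move=> hf k; elim: k m f hf => [|k IH] m f hf.
  by split=> // s; apply: panalytic_val hf.
split=> [s|i]; first by apply: panalytic_val hf.
exact: (IH _ (fun x => f (shiftn2 true x) - f x) (panalytic_diff true hf)).
Qed.

End Slices.

(** * Linear coefficients of [lam] *)

Section DerivedAction.
Variables (A : zmodType) (circ : A -> A -> A) (p n xi : nat).
Hypotheses (p_pr : prime p) (lt_np : (n.+1 < p)%N) (p_gt2 : (2 < p)%N).
Hypothesis brA : is_left_brace circ.
Hypothesis star_pmul :
  forall i j x u, pmul p i x -> pmul p j u -> pmul p (i + j) (star circ x u).
Hypothesis pmul_nil : forall i (x : A), (n <= i)%N -> pmul p i x -> x = 0.
Local Notation q := (p ^ p)%N.
Local Notation zeta := (xi%:R : 'Z_q).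
Hypothesis zeta_exp : zeta ^+ p.-1 = 1.
Hypothesis zeta_unit :
  forall d, (0 < d < p.-1)%N -> zeta ^+ d - 1 \is a GRing.unit.
Local Notation sc := (@sc A q).
Local Notation pmul := (pmul p).
Local Notation fcoef := (@fcoef A p xi).
Local Notation lam := (lam circ).
Local Notation star := (star circ).
Local Notation cinv := (cinv brA).

Lemma fcoef_const x : fcoef 1 (fun=> x) = 0.
Proof.
have := @fcoef_monomial A p n xi p_pr lt_np pmul_nil zeta_exp zeta_unit 0 1 x.
by apply; lia.
Qed.

Lemma panalytic_coef X I (sh : I -> X -> X) m j (F : nat -> X -> A) :
  (forall s, panalytic p sh m (F s)) ->
  panalytic p sh m (fun x => fcoef j (fun s => F s x)).
Proof. by move=> hF; apply: panalytic_sum => t; apply: panalyticMn. Qed.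

Lemma panalytic_coef_slice m j (f : nat * nat -> A) : (j < p.-1)%N ->
  panalytic p shiftn2 m f ->
  panalytic p shiftn (m + j) (fun t => fcoef j (fun s => f (s, t))).
Proof.
move=> ltj hf k; elim: k m f hf => [|k IH] m f hf.
  split=> // t; apply: (@fcoef_panalytic A p n xi) => //.
  exact: panalytic_slice.
split=> [t|i].
  apply: (@fcoef_panalytic A p n xi) => //; exact: panalytic_slice.
apply: panalytic_upto_ext (IH _ _ (panalytic_diff false hf)) => t /=.
by rewrite -sumrB; apply: eq_bigr => s _; rewrite scD scN.
Qed.

(** Chain rule on the diagonal. Writing f(t, t) as the sum of g_j(t) t^j, only the linear
    coefficient of g_0 = f(0, .) and the value g_1(0) contribute. It yields additivity of [dlam_at]
    in the direction. *)
Lemma fcoef1_diag (f : nat * nat -> A) : panalytic p shiftn2 0 f ->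
  fcoef 1 (fun t => f (t, t)) =
  fcoef 1 (fun s => f (s, 0%N)) + fcoef 1 (fun t => f (0%N, t)).
Proof.
move=> hf; pose g j t := fcoef j (fun s => f (s, t)).
have hg j : (j < p.-1)%N -> panalytic p shiftn j (g j).
  by move=> ltj; apply: (panalytic_coef_slice ltj hf).
rewrite (@eq_coef _ _ _ 1 _ (fun t => \sum_(j < p.-1) g j t *+ t ^ j)); last first.
  move=> t; apply: (@panalytic_coefE A p n xi) => //.
  exact: (panalytic_slice t hf).
rewrite fcoef_sum (eq_bigr (fun j : 'I__ => if j == 0%N :> nat then fcoef 1 (g 0%N)
   else if j == 1%N :> nat then g 1%N 0%N else 0)); last first.
  move=> j _; rewrite (@fcoef1_mulXn A p n xi _ _ _ _ _ j (g j)) //; [|lia|exact: hg].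
  by case: eqP => [->|_] //; case: eqP => [->|_].
have [r er] : exists r, p.-1 = r.+2 by exists (p - 3)%N; lia.
rewrite er !big_ord_recl /= big1 ?addr0 => [|i _] //.
rewrite addrC; congr (_ + _); apply: eq_coef => t.
by apply: (@fcoef0_panalytic A p n xi _ _ _ _ _ 0) => //; apply: (panalytic_slice t hf).
Qed.

Lemma lam_coef a j f : lam a (fcoef j f) = fcoef j (fun s => lam a (f s)).
Proof. by rewrite lam_sum //; apply: eq_bigr => t _; rewrite lamMn. Qed.

(* Directional derivatives of lam: the one at u along v, and the one at 0. *)
Definition dlam_at (u v z : A) : A := fcoef 1 (fun t => lam (u + v *+ t) z).
Definition dlam (v z : A) : A := fcoef 1 (fun t => lam (v *+ t) z).

Lemma dlam_at0 v z : dlam_at 0 v z = dlam v z.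
Proof. by apply: eq_coef => t; rewrite add0r. Qed.

Lemma dlam_atD u v w z : pmul 1 v -> pmul 1 w ->
  dlam_at u (v + w) z = dlam_at u v z + dlam_at u w z.
Proof.
move=> hv hw; pose f (x : nat * nat) := lam (u + v *+ x.1 + w *+ x.2) z.
have hf : panalytic p shiftn2 0 f.
  apply: (panalytic_lam brA star_pmul); last by apply: panalytic_const; apply: pmul_all.
  apply: (@panalytic_affine _ _ _ _ _ _ (fun b => if b then v else w)) => [[] //|].
  move=> [] [s t] /=; rewrite mulrSr addrA // -!addrA; congr (_ + _).
  by rewrite addrCA addrC -!addrA [w *+ _ + v]addrC.
rewrite /dlam_at (@eq_coef _ _ _ 1 _ (fun t => f (t, t))); last first.
  by move=> t; rewrite mulrnDl addrA.
rewrite fcoef1_diag //; congr (_ + _); apply: eq_coef => t; rewrite /f /=.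
  by rewrite mulr0n addr0.
by rewrite mulr0n addr0.
Qed.

Lemma dlam_at_0 u z : dlam_at u 0 z = 0.
Proof.
rewrite -[RHS](fcoef_const (lam u z)); apply: eq_coef => t.
by rewrite mul0rn addr0.
Qed.

Lemma dlam_atMn u v z m : pmul 1 v -> dlam_at u (v *+ m) z = dlam_at u v z *+ m.
Proof.
move=> hv; elim: m => [|m IH]; first by rewrite dlam_at_0.
by rewrite !mulrS dlam_atD ?IH //; apply: pmulMn.
Qed.

Lemma dlam_at_sum u z N (F : nat -> A) : (forall j, (j < N)%N -> pmul 1 (F j)) ->
  dlam_at u (\sum_(j < N) F j) z = \sum_(j < N) dlam_at u (F j) z.
Proof.
elim: N => [|N IH] hF; first by rewrite !big_ord0 dlam_at_0.
rewrite !big_ord_recr /= dlam_atD ?IH //; last by apply: hF.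
- by move=> j ltj; apply: hF; apply: ltnW.
by apply: pmul_sum => j _; apply: hF; exact: ltnW (ltn_ord j).
Qed.

Lemma dlamDl v w z : pmul 1 v -> pmul 1 w -> dlam (v + w) z = dlam v z + dlam w z.
Proof. by rewrite -!dlam_at0; apply: dlam_atD. Qed.

Lemma dlamMnl v z m : pmul 1 v -> dlam (v *+ m) z = dlam v z *+ m.
Proof. by rewrite -!dlam_at0; apply: dlam_atMn. Qed.

Lemma dlamDr v z z' : dlam v (z + z') = dlam v z + dlam v z'.
Proof. by rewrite -fcoefD; apply: eq_coef => t; rewrite lamD. Qed.

Lemma dlamMnr v z m : dlam v (z *+ m) = dlam v z *+ m.
Proof. by rewrite -fcoefMn; apply: eq_coef => t; rewrite lamMn. Qed.

Lemma panalytic_mulrn (a : A) : pmul 1 a -> panalytic p shiftn 0 (fun s => a *+ s).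
Proof.
move=> ha; apply: (@panalytic_affine _ _ _ _ _ _ (fun=> a)) => // i s.
by rewrite mulrSr.
Qed.

Lemma fcoef_star v z : fcoef 1 (fun s => star (v *+ s) z) = dlam v z.
Proof.
rewrite -[LHS]addr0 -[X in _ + X](fcoef_const z) -fcoefD.
by apply: eq_coef => s; rewrite -lamE.
Qed.

Lemma dlam_pmul v z : pmul 1 v -> pmul 1 (dlam v z).
Proof.
move=> hv; apply: (@fcoef_panalytic A p n xi _ _ _ _ _ 0 1) => //; first by lia.
apply: (panalytic_lam brA star_pmul); first exact: panalytic_mulrn.
by apply: panalytic_const; apply: pmul_all.
Qed.

(** By [lamDl], lam_(s a + t v) z is a term constant in t, without linear coefficient, plus a [star]
    term that inherits the factor p^j of v. That factor is what [fcoef1_mulXn] asks for. *)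
Lemma panalytic_dlam_at (a v z : A) j : pmul 1 a -> pmul j v ->
  panalytic p shiftn j (fun s => dlam_at (a *+ s) v z).
Proof.
move=> ha hv.
pose F t s := lam (a *+ s) (star (lam (cinv (a *+ s)) (v *+ t)) z).
apply: (@panalytic_ext _ _ _ _ _ _ (fun s => fcoef 1 (fun t => F t s))).
  move=> s; rewrite -[LHS]addr0 -[X in _ + X](fcoef_const (lam (a *+ s) z)) -fcoefD.
  by apply: eq_coef => t; rewrite addrC -lamDl.
have ha0 := panalytic_mulrn ha.
apply: panalytic_coef => t; apply: (panalytic_lam brA star_pmul) => //.
rewrite -[j]addn0; apply: (panalytic_star brA star_pmul).
  by apply: (panalytic_lamV brA star_pmul) => //; apply: panalytic_const; apply: pmulMn.
by apply: panalytic_const; apply: pmul_all.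
Qed.

(** The coefficient of s t in lam_(s a + t b) z; its symmetry in a and b is the source of the
    pre-Lie identity. *)
Definition mixed_coef (a b z : A) : A :=
  fcoef 1 (fun s => fcoef 1 (fun t => lam (a *+ s + b *+ t) z)).

Lemma mixed_coefC a b z : mixed_coef a b z = mixed_coef b a z.
Proof.
rewrite /mixed_coef (@fcoefC A p n) //.
by apply: eq_coef => s; apply: eq_coef => t; rewrite addrC.
Qed.

(* Compares the coefficients of st in
   lam (s a) (lam (t b) z) = lam (s a + t lam (s a) b) z. *)
Lemma dlam_comp a b z : pmul 1 a -> pmul 1 b ->
  dlam a (dlam b z) = mixed_coef a b z + dlam (dlam a b) z.
Proof.
move=> ha hb; have ha0 := panalytic_mulrn ha.
pose h s := star (a *+ s) b; pose g j := fcoef j h.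
have hh : panalytic p shiftn 1 h.
  by apply: (@panalytic_star _ _ _ _ _ _ brA star_pmul 0 1) => //; apply: panalytic_const.
have hg j : (j < p.-1)%N -> pmul (1 + j) (g j).
  by move=> ltj; apply: (@fcoef_panalytic A p n xi).
have hg1 j : (j < p.-1)%N -> pmul 1 (g j).
  by move=> ltj; apply: pmulW (hg j ltj); lia.
have hE s : h s = \sum_(j < p.-1) g j *+ s ^ j.
  by apply: (@panalytic_coefE A p n xi _ _ _ _ _ 1).
have -> : dlam a (dlam b z) = fcoef 1 (fun s => dlam_at (a *+ s) (h s + b) z).
  apply: eq_coef => s; rewrite lam_coef; apply: eq_coef => t.
  by rewrite -lam_circ // (circE circ) lamMn // /h -lamE.
rewrite (@eq_coef _ _ _ 1 _ (fun s => dlam_at (a *+ s) b z +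
   \sum_(j < p.-1) dlam_at (a *+ s) (g j) z *+ s ^ j)); last first.
  move=> s; rewrite addrC dlam_atD //; last first.
    by apply: (@star_pmul 1 0); [apply: pmulMn | apply: pmul_all].
  congr (_ + _); rewrite hE (@dlam_at_sum _ _ _ (fun j => g j *+ s ^ j)).
    by apply: eq_bigr => j _; rewrite dlam_atMn //; apply: hg1.
  by move=> j ltj; apply: pmulMn; apply: hg1.
rewrite fcoefD; congr (_ + _); rewrite fcoef_sum.
(* Only j = 1 survives: g 0 = h 0 = 0, and j >= 2 has no linear part. Moreover g 1 is [dlam a b]. *)
rewrite (eq_bigr (fun j : 'I__ => if j == 1%N :> nat then dlam (g 1%N) z else 0)).
  have [r er] : exists r, p.-1 = r.+2 by exists (p - 3)%N; lia.
  rewrite er !big_ord_recl /= big1 ?addr0 ?add0r => [|i _] //.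
  by congr (dlam _ _); apply: fcoef_star.
move=> j _; have ltj := ltn_ord j.
rewrite (@fcoef1_mulXn A p n xi _ _ _ _ _ j (fun s => dlam_at (a *+ s) (g j) z)) //.
- case: eqP => [->|_].
    have -> : g 0%N = 0.
      rewrite /g (@fcoef0_panalytic A p n xi _ _ _ _ _ 1) //.
      by rewrite /h mulr0n star0l.
    rewrite -[RHS](fcoef_const 0); apply: eq_coef => s; exact: dlam_at_0.
  by case: eqP => [->|_] //; rewrite mulr0n dlam_at0.
- by lia.
by apply: panalytic_dlam_at => //; apply: pmulW (hg j ltj); lia.
Qed.

(** Clears the denominator p - 1 and reaches the weights of [bullet]: zeta^((p-2)t) and zeta^(p-1-t)
    are both inverse to zeta^t. *)
Lemma fcoef1E f : fcoef 1 f *+ p.-1 = \sum_(t < p.-1) f (xi ^ t)%N *+ xi ^ (p.-1 - t).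
Proof.
have q1 := q_gt1 p_pr; have mq := mulrn_q p_pr lt_np pmul_nil.
rewrite -sumrMnl; apply: eq_bigr => t _.
rewrite -[LHS](sc_nat q1 mq) -(scM q1 mq) mulrA mulrV ?mul1r; last first.
  by apply: (@natr_unit p); lia.
rewrite -[RHS](sc_nat q1 mq) natrX; congr (sc _ _).
have zU : zeta ^+ t \is a GRing.unit.
  rewrite unitrX //; apply/unitrP; exists (zeta ^+ p.-2).
  by rewrite -exprSr -exprS prednK ?zeta_exp //; lia.
apply: (mulIr zU); rewrite -!exprD subnK ?zeta_exp; last exact: ltnW.
by rewrite -{2}[t : nat]mul1n -mulnDl subnK ?exprM ?zeta_exp ?expr1n //; lia.
Qed.

End DerivedAction.

(** * The root of unity built from gamma *)

Lemma dvdn_predn_exp p x k :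
  (0 < x)%N -> (p %| x.-1)%N -> (p ^ k.+1 %| (x ^ (p ^ k)).-1)%N.
Proof.
move=> x0 px; elim: k => [|k IH]; first by rewrite expn1.
have -> : (x ^ p ^ k.+1 = (x ^ p ^ k) ^ p)%N by rewrite -expnM -expnSr.
(* With y = x^(p^k), the cofactor of y - 1 in y^p - 1 is a sum of p powers of y, each congruent to 1
   modulo p, hence divisible by p. *)
rewrite expnSr predn_exp; apply: dvdn_mul => //.
have px' : (p %| (x ^ p ^ k).-1)%N by rewrite predn_exp dvdn_mulr.
set y := (x ^ p ^ k)%N in px' *; have y0 : (0 < y)%N by rewrite expn_gt0 x0.
rewrite (eq_bigr (fun i : 'I_p => (y ^ i).-1 + 1)%N); last first.
  by move=> i _; rewrite addn1 prednK // expn_gt0 y0.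
rewrite big_split sum_nat_const card_ord muln1 dvdn_addl // dvdn_sum // => i _.
by rewrite predn_exp dvdn_mulr.
Qed.

Section RootOfUnity.
Variables (p gamma : nat).
Hypotheses (p_pr : prime p).
Hypothesis gamma_prim : (totient (p ^ p)).-primitive_root (gamma%:R : 'Z_(p ^ p)).
Local Notation zeta := ((gamma ^ (p ^ p.-1))%:R : 'Z_(p ^ p)).

Lemma totient_pp : totient (p ^ p) = (p ^ p.-1 * p.-1)%N.
Proof. by rewrite totient_pfactor ?prime_gt0 // mulnC. Qed.

Lemma root_exp : zeta ^+ p.-1 = 1.
Proof. by rewrite natrX -exprM -totient_pp prim_expr_order. Qed.

(** If p divided zeta^d - 1, raising to the power p^(p-1) would give 1 modulo p^p. The order p^(p-1)
    (p-1) of gamma would then force p - 1 to divide d. *)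
Lemma root_unit d : (0 < d < p.-1)%N -> zeta ^+ d - 1 \is a GRing.unit.
Proof.
move=> /andP[d0 ltd]; set xi := (gamma ^ _)%N.
have q1 : (1 < p ^ p)%N by rewrite -{1}(exp1n p) ltn_exp2r ?prime_gt1 ?prime_gt0.
have x0 : (0 < xi ^ d)%N.
  rewrite expn_gt0; case: (posnP xi) => // xi0; have := root_exp.
  rewrite -/xi xi0 expr0n (_ : (p.-1 == 0)%N = false); last by lia.
  by move/esym/eqP; rewrite oner_eq0.
rewrite -natrX -(natrB _ x0) subn1 unitZpE // coprimeXl // prime_coprime //.
apply/negP=> /(dvdn_predn_exp p.-1 x0); rewrite prednK ?prime_gt0 //.
set y := ((xi ^ d) ^ (p ^ p.-1))%N => dv; have y0 : (0 < y)%N by rewrite expn_gt0 x0.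
have /eqP : (y%:R : 'Z_(p ^ p)) = 1.
  have -> : y = (y.-1 + 1)%N by rewrite addn1 prednK.
  by case/dvdnP: dv => c ->; rewrite natrD natrM pchar_Zp // mulr0 add0r.
rewrite /y /xi !natrX -!exprM -(prim_order_dvd gamma_prim) totient_pp.
rewrite dvdn_pmul2l ?expn_gt0 ?prime_gt0 // Gauss_dvdl.
  by move/(dvdn_leq d0); lia.
by rewrite coprimeXr // coprime_sym prime_coprime // gtnNdvd //; lia.
Qed.

End RootOfUnity.

(** * The pre-Lie ring on A / ann(p^2) *)

Theorem theorem8p1 (A : finZmodType) (circ : A -> A -> A) (p n gamma : nat)
    (wp : A -> A) :
  is_left_brace circ ->
  prime p -> #|A| = (p ^ n)%N -> (n.+1 < p)%N ->
  (totient (p ^ p)).-primitive_root (gamma%:R : 'Z_(p ^ p)) ->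
  (forall a : A, wp (a *+ p) *+ p = a *+ p) ->
  preLie_mod (mod_ann (p ^ 2))
    (bullet p (gamma ^ (p ^ p.-1)) circ wp).
Proof.
move=> brA p_pr cardA lt_np gamma_prim wpE; set xi := (gamma ^ _)%N.
(* For p = 2 the bound on n gives n = 0 and A is trivial; otherwise p - 1 > 1, so linear
   coefficients make sense. *)
have [p_gt2|p_le2] := ltnP 2 p; last first.
  have A0 (x : A) : x = 0.
    by apply: (pmul_nil cardA (i := 0)); [lia | apply: pmul_all].
  by split=> *; rewrite /mod_ann [_ *+ _]A0.
have modE (u v : A) : mod_ann (p ^ 2) u v <-> u *+ p *+ p = v *+ p *+ p.
  by rewrite /mod_ann mulrnBl !mulrnA; split=> [/subr0_eq|->]; rewrite ?subrr.
have zE := root_exp p_pr gamma_prim; have zU := root_unit p_pr gamma_prim.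
have sp := @star_pmul A circ p n brA p_pr cardA lt_np.
have pn := @pmul_nil A p n cardA.
pose d := dlam circ p xi; pose op := bullet p xi circ wp.
have pmp (x : A) : pmul p 1 (x *+ p) by exists x.
have dDl v w z : pmul p 1 v -> pmul p 1 w -> d (v + w) z = d v z + d w z.
  exact: (@dlamDl A circ p n).
have dMl v z m : pmul p 1 v -> d (v *+ m) z = d v z *+ m.
  exact: (@dlamMnl A circ p n).
have dDr v z z' : d v (z + z') = d v z + d v z' by apply: dlamDr.
have dMr v z m : d v (z *+ m) = d v z *+ m by apply: dlamMnr.
have d_ann a v : pmul p 1 a -> v *+ p = 0 -> d a v = 0.
  move=> ha pv; rewrite -[LHS](@fcoef_star A circ p n xi) //.
  rewrite -[RHS](@fcoef_const A p n xi p_pr lt_np p_gt2 pn zE zU 0).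
  by apply: eq_coef => s; apply: (star_ann brA p_pr cardA lt_np) => //; apply: pmulMn.
have opE x y : op x y *+ p = d (x *+ p) y *+ p.-1.
  rewrite -[d _ _](@fcoef_star A circ p n xi) // (@fcoef1E A p n) //.
  rewrite -sumrMnl; apply: eq_bigr => t _; rewrite mulrnAC; congr (_ *+ _).
  (* The argument of [wp] is a multiple of p, so multiplying by p undoes [wp]. *)
  have [v] : pmul p 1 (star circ (x *+ p *+ xi ^ t) y).
    by apply: (sp 1%N 0%N); [apply: pmulMn | apply: pmul_all].
  rewrite /odot brace_starE mulrnAC => e.
  by rewrite e wpE.
split.
- move=> x x' y y' /modE ex /modE ey; apply/modE.
  rewrite !opE !(mulrnAC _ p.-1); congr (_ *+ _).
  (* The spare factor p is moved into the first argument to replace x by x', then into the second,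
     where p (y - y') is killed by p and [d_ann] applies. *)
  rewrite -(dMl (x *+ p)) // ex (dMl (x' *+ p)) // -!dMr.
  rewrite -[y *+ p](subrK (y' *+ p)) dDr d_ann ?add0r //.
  by rewrite mulrnBl ey subrr.
- move=> x x' y; apply/modE; rewrite !(mulrnDl p) !opE mulrnDl.
  by rewrite dDl // !mulrnDl.
- by move=> x y y'; apply/modE; rewrite !(mulrnDl p) !opE dDr !mulrnDl.
(* Times p^2, both ways of bracketing equal (p - 1)^2 times an expression in [d], so the identity
   need only be checked for [d]. *)
have op2 x y z : op (op x y) z *+ p *+ p
    = d (d (x *+ p) (y *+ p)) z *+ p.-1 *+ p.-1.
  rewrite !opE dMr; set a := d (x *+ p) y.
  have ha : pmul p 1 a by apply: (@dlam_pmul A circ p n).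
  by rewrite !(dMl a) // !(mulrnAC _ p).
have op3 x y z : op x (op y z) *+ p *+ p
    = d (x *+ p) (d (y *+ p) z) *+ p.-1 *+ p.-1.
  by rewrite opE (mulrnAC _ p.-1 p) -(dMr (x *+ p) (op y z)) opE dMr.
have dcomp a b w : pmul p 1 a -> pmul p 1 b ->
    d a (d b w) = mixed_coef circ p xi a b w + d (d a b) w.
  exact: (@dlam_comp A circ p n).
have preLie a b w : pmul p 1 a -> pmul p 1 b ->
    d (d a b) w - d a (d b w) = d (d b a) w - d b (d a w).
  (* By [dcomp] each side is minus the mixed coefficient. *)
  move=> ha hb; rewrite !dcomp // (@mixed_coefC A circ p n xi p_pr lt_np pn b).
  by rewrite !opprD !(addrCA (d _ _)) !subrr.
move=> x y z; apply/modE; rewrite !mulrnBl !op2 !op3 -!mulrnBl.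
by rewrite preLie.
Qed.
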